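(* Let $0<q<1$, $\alpha\in\mathbb{C}^*$, $d\in\mathbb{R}$ (mod $2\pi\mathbb{Z}$) and $R>0$. Every $\mathcal{C}^\infty$ solution of $$y'(x)=\alpha\,y(qx)-y(x)$$ on $[0,Re^{id})$ can be analytically continued to an entire function. Accordingly, this equation has no nontrivial $\mathcal{C}^\infty$ solution on $[0,Re^{id})$ such that $y(0)=0$.
   Context: $[0,Re^{id})=\{te^{id}:0\le t<R\}$ denotes a half-open segment in the complex plane; $y$ is complex-valued and derivatives are taken with respect to $x$ along this segment. ''Nontrivial'' means not identically zero. *)

(* Defs.v *)
From Stdlib Require Import Reals.
From Coquelicot Require Import Coquelicot.
Open Scope C_scope.

(* Coquelicot has no complex exponential. *)
Definition expi (d : R) : C := (cos d, sin d).

Definition segment (r d : R) (x : C) : Prop :=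
  exists t : R, (0 <= t < r)%R /\ x = RtoC t * expi d.

(* [is_derive] with [locally x] restricted to [D]: the difference quotient is
   taken along [D] only (hence one-sided at an end point of a segment), and the
   values of [f] off [D] are irrelevant. *)
Definition is_derive_on (D : C -> Prop) (f : C -> C) (x l : C) : Prop :=
  filterdiff (K := C_AbsRing) (U := AbsRing_NormedModule C_AbsRing)
    (V := C_NormedModule) f
    (within D (locally (T := AbsRing_UniformSpace C_AbsRing) x)) (fun h => scal h l).

(* [F n] is the [n]-th derivative of [f] along [D]. *)
Definition smooth_on (D : C -> Prop) (f : C -> C) : Prop :=
  exists F : nat -> C -> C,
    (forall x, D x -> F 0%nat x = f x) /\
    (forall n x, D x -> is_derive_on D (F n) x (F (S n) x)).

Definition entire (f : C -> C) : Prop :=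
  forall z : C, ex_derive (K := C_AbsRing) (V := C_NormedModule) f z.

Definition smooth_solution_on (q : R) (alpha : C) (D : C -> Prop) (y : C -> C)
    : Prop :=
  smooth_on D y /\
  (forall x, D x -> is_derive_on D y x (alpha * y (RtoC q * x) - y x)).

(* Main.v *)
Require Import Defs.
From Stdlib Require Import Reals Lra Lia.
From Coquelicot Require Import Coquelicot.
Open Scope C_scope.

(** Substituting a power series [sum a_n x^n] into the equation gives
    [(n+1) a_(n+1) = (alpha q^n - 1) a_n].  Since [0 < q < 1], the factors
    [alpha q^n - 1] are bounded by [K = |alpha| + 1], hence
    [|a_n| <= |a_0| K^n / n!]: for each value [a_0] there is an entire solution
    [f] with [f 0 = a_0] ([entire_coeffs_sol_coeff], [is_derive_powser_sol]).

    It remains to see that a solution [w] on the segment with [w 0 = 0] is zero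
    ([solution_vanishes]); the first claim follows by taking [w = y - f] with
    [a_0 = y 0], and the second by taking [w = y].  As [q < 1], the equation at
    the parameter [t] only involves [w] at the parameters [q t] and [t], so a
    Gronwall argument in an exponentially weighted norm works.  On a compact
    part [0 <= t <= T] of the segment, suppose that [|w| <= M exp (L t)]
    with [L = 2 K].  Then [|w'| <= K M exp (L t)], and integrating from
    [w 0 = 0] yields [|w| <= (M / 2) exp (L t)] ([solution_bound_halves]).
    A first bound [M] exists by compactness, and halving it forever gives
    [w = 0]. *)

(** * Derivatives along a set *)

Lemma Cminus_eq_0 (u v : C) : u - v = 0 -> u = v.
Proof. intros E. replace u with (v + (u - v)) by ring. rewrite E. ring. Qed.

(** The filter of neighbourhoods of [x] within [D] converges only to [x], because
    [x] itself lies in [D]; hence the quantification over limit points in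
    [filterdiff] collapses to a single epsilon-delta condition. *)
Lemma is_derive_on_iff (D : C -> Prop) (f : C -> C) (x l : C) (Dx : D x) :
  is_derive_on D f x l <->
  (forall eps : R, (0 < eps)%R -> exists delta : R, (0 < delta)%R /\
     forall z, D z -> (Cmod (z - x) < delta)%R ->
       (Cmod (f z - f x - (z - x) * l) <= eps * Cmod (z - x))%R).
Proof.
split.
- intros [_ H] eps heps.
  assert (Hx : is_filter_lim (T := AbsRing_UniformSpace C_AbsRing)
                 (within D (locally (T := AbsRing_UniformSpace C_AbsRing) x)) x).
  { intros P [e He]. exists e. auto. }
  destruct (H x Hx (mkposreal eps heps)) as [delta Hd].
  exists delta. split; [apply cond_pos|].
  intros z Dz Hz. exact (Hd z Hz Dz).
- intros H. split; [exact (is_linear_scal_l (V := C_NormedModule) l)|].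
  intros x' Hx'.
  assert (E : x' = x).
  { destruct (Req_dec (Cmod (x - x')) 0) as [E|E].
    - apply Cmod_eq_0 in E. symmetry. exact (Cminus_eq_0 _ _ E).
    - assert (P0 : (0 < Cmod (x - x'))%R) by (generalize (Cmod_ge_0 (x - x')); lra).
      destruct (Hx' (ball (M := AbsRing_UniformSpace C_AbsRing) x' (Cmod (x - x'))))
        as [delta Hd].
      + exists (mkposreal _ P0). intros y Hy. exact Hy.
      + exfalso. specialize (Hd x (ball_center (M := AbsRing_UniformSpace C_AbsRing) x delta) Dx).
        change (Cmod (x - x') < Cmod (x - x'))%R in Hd. lra. }
  subst x'. intros eps.
  destruct (H eps (cond_pos eps)) as [delta [Pd Hd]].
  exists (mkposreal delta Pd). intros z Hz Dz. exact (Hd z Dz Hz).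
Qed.

Lemma is_derive_on_subset (D E : C -> Prop) (f : C -> C) (x l : C) :
  (forall z, D z -> E z) -> D x -> is_derive_on E f x l -> is_derive_on D f x l.
Proof.
intros HDE Dx H. apply is_derive_on_iff; [assumption|].
rewrite is_derive_on_iff in H by auto.
intros eps heps. destruct (H eps heps) as [delta [Pd Hd]].
exists delta. split; auto.
Qed.

Lemma is_derive_on_full (f : C -> C) (x l : C) :
  is_derive_on (fun _ => True) f x l ->
  is_derive (K := C_AbsRing) (V := C_NormedModule) f x l.
Proof.
intros [Hl H]. split; [exact Hl|].
intros x' Hx' eps.
assert (Hx'' : is_filter_lim (T := AbsRing_UniformSpace C_AbsRing)
   (within (fun _ => True) (locally (T := AbsRing_UniformSpace C_AbsRing) x)) x').
{ intros P HP. destruct (Hx' P HP) as [e He]. exists e. auto. }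
destruct (H x' Hx'' eps) as [e He]. exists e. auto.
Qed.

Lemma is_derive_on_minus (D : C -> Prop) (f g : C -> C) (x lf lg : C) :
  D x -> is_derive_on D f x lf -> is_derive_on D g x lg ->
  is_derive_on D (fun z => f z - g z) x (lf - lg).
Proof.
intros Dx Hf Hg. apply is_derive_on_iff; [assumption|].
rewrite is_derive_on_iff in Hf, Hg by assumption.
intros eps heps.
destruct (Hf (eps / 2)%R ltac:(lra)) as [df [Pf Kf]].
destruct (Hg (eps / 2)%R ltac:(lra)) as [dg [Pg Kg]].
exists (Rmin df dg). split; [apply Rmin_pos; assumption|].
intros z Dz Hz.
assert (H1 := Kf z Dz (Rlt_le_trans _ _ _ Hz (Rmin_l _ _))).
assert (H2 := Kg z Dz (Rlt_le_trans _ _ _ Hz (Rmin_r _ _))).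
replace (f z - g z - (f x - g x) - (z - x) * (lf - lg))
  with ((f z - f x - (z - x) * lf) + - (g z - g x - (z - x) * lg)) by ring.
eapply Rle_trans; [apply Cmod_triangle|]. rewrite Cmod_opp. lra.
Qed.

(** * Absolutely convergent complex series *)

Definition abs_summable (u : nat -> C) : Prop := ex_series (fun n => Cmod (u n)).

(** Summing the real and imaginary parts separately gives access to the theory of
    real series, at the price of a factor 2 in [Cmod_CSeries_le]. *)
Definition CSeries (u : nat -> C) : C :=
  (Series (fun n => Re (u n)), Series (fun n => Im (u n))).

Lemma Rabs_Im_le_Cmod (c : C) : (Rabs (Im c) <= Cmod c)%R.
Proof. eapply Rle_trans; [apply Rmax_r|apply Rmax_Cmod]. Qed.

Lemma abs_summable_le (u : nat -> C) (b : nat -> R) :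
  (forall n, (Cmod (u n) <= b n)%R) -> ex_series b -> abs_summable u.
Proof.
intros H Hb. apply (ex_series_le (K := R_AbsRing) (V := R_CompleteNormedModule)) with b; auto.
intros n. change (Rabs (Cmod (u n)) <= b n)%R.
rewrite Rabs_pos_eq; [apply H|apply Cmod_ge_0].
Qed.

Lemma ex_series_Re (u : nat -> C) : abs_summable u -> ex_series (fun n => Re (u n)).
Proof.
intros H. apply (ex_series_le (K := R_AbsRing) (V := R_CompleteNormedModule)) with (2 := H).
intros n. apply re_le_Cmod.
Qed.

Lemma ex_series_Im (u : nat -> C) : abs_summable u -> ex_series (fun n => Im (u n)).
Proof.
intros H. apply (ex_series_le (K := R_AbsRing) (V := R_CompleteNormedModule)) with (2 := H).
intros n. apply Rabs_Im_le_Cmod.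
Qed.

Lemma abs_summable_plus (u v : nat -> C) :
  abs_summable u -> abs_summable v -> abs_summable (fun n => u n + v n).
Proof.
intros Hu Hv. apply abs_summable_le with (fun n => (Cmod (u n) + Cmod (v n))%R).
- intros n. apply Cmod_triangle.
- exact (ex_series_plus _ _ Hu Hv).
Qed.

Lemma abs_summable_scal (c : C) (u : nat -> C) :
  abs_summable u -> abs_summable (fun n => c * u n).
Proof.
intros Hu. apply abs_summable_le with (fun n => (Cmod c * Cmod (u n))%R).
- intros n. rewrite Cmod_mult. apply Rle_refl.
- exact (ex_series_scal_l (Cmod c) _ Hu).
Qed.

Lemma CSeries_ext (u v : nat -> C) :
  (forall n, u n = v n) -> CSeries u = CSeries v.
Proof.
intros H. unfold CSeries. f_equal; apply Series_ext; intros n; now rewrite H.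
Qed.

Lemma CSeries_plus (u v : nat -> C) :
  abs_summable u -> abs_summable v ->
  CSeries (fun n => u n + v n) = CSeries u + CSeries v.
Proof.
intros Hu Hv. unfold CSeries, Cplus; simpl.
f_equal; apply Series_plus; auto using ex_series_Re, ex_series_Im.
Qed.

Lemma CSeries_scal (c : C) (u : nat -> C) :
  abs_summable u -> CSeries (fun n => c * u n) = c * CSeries u.
Proof.
intros Hu. assert (Hr := ex_series_Re u Hu). assert (Hi := ex_series_Im u Hu).
unfold CSeries, Cmult; simpl. f_equal.
- rewrite Series_minus.
  + now rewrite !Series_scal_l.
  + exact (ex_series_scal_l (fst c) _ Hr).
  + exact (ex_series_scal_l (snd c) _ Hi).
- rewrite Series_plus.
  + now rewrite !Series_scal_l.
  + exact (ex_series_scal_l (fst c) _ Hi).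
  + exact (ex_series_scal_l (snd c) _ Hr).
Qed.

Lemma CSeries_incr_1 (u : nat -> C) :
  abs_summable u -> CSeries u = u 0%nat + CSeries (fun n => u (S n)).
Proof.
intros Hu. unfold CSeries, Cplus; simpl.
f_equal; apply (Series_incr_1 (fun n => _ (u n))); auto using ex_series_Re, ex_series_Im.
Qed.

Lemma Cmod_CSeries_le (u : nat -> C) (b : nat -> R) :
  (forall n, (Cmod (u n) <= b n)%R) -> ex_series b ->
  (Cmod (CSeries u) <= 2 * Series b)%R.
Proof.
intros H Hb.
assert (K : forall p : C -> R, (forall c, (Rabs (p c) <= Cmod c)%R) ->
            (Rabs (Series (fun n => p (u n))) <= Series b)%R).
{ intros p Hp.
  assert (Hn : forall n, (0 <= Rabs (p (u n)) <= b n)%R).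
  { intros n. split; [apply Rabs_pos|]. eapply Rle_trans; [apply Hp|apply H]. }
  eapply Rle_trans; [apply Series_Rabs|apply Series_le; assumption].
  apply (ex_series_le (K := R_AbsRing) (V := R_CompleteNormedModule)) with (2 := Hb).
  intros n. change (Rabs (Rabs (p (u n))) <= b n)%R. rewrite Rabs_Rabsolu. apply Hn. }
replace (CSeries u) with (RtoC (Re (CSeries u)) + Ci * RtoC (Im (CSeries u))).
2: { unfold CSeries, Cplus, Cmult, RtoC, Ci, Re, Im; simpl; f_equal; ring. }
eapply Rle_trans; [apply Cmod_triangle|].
rewrite Cmod_mult, Cmod_Ci, !Cmod_R.
assert (H1 := K Re re_le_Cmod). assert (H2 := K Im Rabs_Im_le_Cmod).
unfold CSeries; simpl. lra.
Qed.

(** * Everywhere convergent power series *)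

Definition powser (a : nat -> C) (x : C) : C := CSeries (fun n => a n * x ^ n).

(** Infinite radius of convergence, in the form of absolute convergence at every
    radius. *)
Definition entire_coeffs (a : nat -> C) : Prop :=
  forall rho : R, (0 <= rho)%R -> ex_series (fun n => (Cmod (a n) * rho ^ n)%R).

Lemma abs_summable_powser (a : nat -> C) (x : C) :
  entire_coeffs a -> abs_summable (fun n => a n * x ^ n).
Proof.
intros Ha. apply abs_summable_le with (2 := Ha (Cmod x) (Cmod_ge_0 x)).
intros n. rewrite Cmod_mult, Cmod_pow. apply Rle_refl.
Qed.

Lemma INR_le_pow4 (n : nat) : (INR n <= 4 ^ n)%R.
Proof.
induction n as [|n IH]; [simpl; lra|].
rewrite S_INR. simpl. assert (1 <= 4 ^ n)%R by (apply pow_R1_Rle; lra). lra.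
Qed.

Lemma Cmod_pow_le (x : C) (rho : R) (n : nat) :
  (Cmod x <= rho)%R -> (Cmod (x ^ n) <= rho ^ n)%R.
Proof.
intros H. rewrite Cmod_pow. apply pow_incr. split; [apply Cmod_ge_0|exact H].
Qed.

(** The Taylor remainder [E_n] of [z^n] at [x] satisfies
    [E_(n+1) = z E_n + (z - x)^2 n x^(n-1)], whence the bound by induction.  The
    crude factor [4^n], which absorbs the polynomial growth in [n], is harmless
    for a series converging at every radius.  At [n = 0] the exponent [pred n] is
    0 instead of -1, but its coefficient [INR n] vanishes. *)
Lemma Cmod_pow_taylor_le (x z : C) (rho : R) (n : nat) :
  (1 <= rho)%R -> (Cmod x <= rho)%R -> (Cmod z <= rho)%R ->
  (Cmod (z ^ n - x ^ n - (z - x) * (RtoC (INR n) * x ^ pred n))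
     <= (Cmod (z - x)) ^ 2 * (4 * rho) ^ n)%R.
Proof.
intros hr hx hz.
induction n as [|n IH].
- simpl. replace (1 - 1 - (z - x) * (0 * 1)) with (RtoC 0) by ring.
  rewrite Cmod_0. generalize (Cmod_ge_0 (z - x)). nra.
- set (E := z ^ n - x ^ n - (z - x) * (RtoC (INR n) * x ^ pred n)) in *.
  replace (z ^ S n - x ^ S n - (z - x) * (RtoC (INR (S n)) * x ^ pred (S n)))
    with (z * E + (z - x) * (z - x) * (RtoC (INR n) * x ^ pred n)).
  2: { unfold E. rewrite S_INR, RtoC_plus. destruct n as [|n].
       - simpl. ring.
       - simpl pred. rewrite !Cpow_S. ring. }
  eapply Rle_trans; [apply Cmod_triangle|].
  rewrite !Cmod_mult, Cmod_R, Rabs_pos_eq by apply pos_INR.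
  assert (hp : (Cmod (x ^ pred n) <= rho ^ n)%R).
  { eapply Rle_trans; [apply Cmod_pow_le; exact hx|].
    apply Rle_pow; [exact hr|lia]. }
  assert (h4 := INR_le_pow4 n). assert (hn := pos_INR n).
  assert (hrn : (1 <= rho ^ n)%R) by (apply pow_R1_Rle; exact hr).
  assert (h4n : (1 <= 4 ^ n)%R) by (apply pow_R1_Rle; lra).
  set (H := Cmod (z - x)) in *. assert (hH : (0 <= H)%R) by apply Cmod_ge_0.
  assert (A : (Cmod z * Cmod E <= rho * (H ^ 2 * (4 * rho) ^ n))%R)
    by (apply Rmult_le_compat; auto using Cmod_ge_0).
  assert (B : (INR n * Cmod (x ^ pred n) <= 4 ^ n * (rho * rho ^ n))%R).
  { apply Rmult_le_compat; auto using Cmod_ge_0. nra. }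
  (* What is left is [4^n rho^(n+1) + n rho^n <= 4^(n+1) rho^(n+1)]. *)
  rewrite Rpow_mult_distr in *. simpl pow in *.
  assert (B2 : (H * H * (INR n * Cmod (x ^ pred n)) <= H * H * (4 ^ n * (rho * rho ^ n)))%R)
    by (apply Rmult_le_compat_l; [nra|exact B]).
  assert (0 <= (H * H) * (4 ^ n * (rho * rho ^ n)))%R.
  { apply Rmult_le_pos; [nra|]. apply Rmult_le_pos; [lra|]. apply Rmult_le_pos; lra. }
  nra.
Qed.

Lemma entire_coeffs_derive (a : nat -> C) :
  entire_coeffs a -> entire_coeffs (fun n => RtoC (INR (S n)) * a (S n)).
Proof.
intros Ha rho hrho.
assert (hr : (0 <= 4 * (rho + 1))%R) by lra.
assert (H := Ha _ hr).
apply (ex_series_incr_1 (fun n => (Cmod (a n) * (4 * (rho + 1)) ^ n)%R)) in H.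
apply (ex_series_le (K := R_AbsRing) (V := R_CompleteNormedModule)) with (2 := H).
intros n.
change (Rabs (Cmod (RtoC (INR (S n)) * a (S n)) * rho ^ n)
        <= Cmod (a (S n)) * (4 * (rho + 1)) ^ S n)%R.
rewrite Cmod_mult, Cmod_R, (Rabs_pos_eq (INR (S n))) by apply pos_INR.
assert (P0 : (0 <= rho ^ n)%R) by (apply pow_le; lra).
assert (P1 : (rho ^ n <= (rho + 1) ^ S n)%R).
{ apply Rle_trans with ((rho + 1) ^ n)%R; [apply pow_incr; lra|].
  apply Rle_pow; [lra|lia]. }
assert (P2 := Cmod_ge_0 (a (S n))). assert (P3 := pos_INR (S n)).
rewrite Rabs_pos_eq by (repeat apply Rmult_le_pos; assumption).
rewrite Rpow_mult_distr.
replace (INR (S n) * Cmod (a (S n)) * rho ^ n)%R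
  with (Cmod (a (S n)) * (INR (S n) * rho ^ n))%R by ring.
apply Rmult_le_compat_l; [exact P2|].
apply Rmult_le_compat; auto. apply INR_le_pow4.
Qed.

(** Termwise differentiation: by [Cmod_pow_taylor_le] the remainder at [z] is at
    most a constant times [|z - x|^2], uniformly on the unit disc around [x]. *)
Lemma is_derive_powser (a : nat -> C) (x : C) :
  entire_coeffs a ->
  is_derive_on (fun _ => True) (powser a) x
    (powser (fun n => RtoC (INR (S n)) * a (S n)) x).
Proof.
intros Ha. apply is_derive_on_iff; [exact I|].
(* This radius bounds both [x] and every [z] with [|z - x| < 1]. *)
set (rho := (Cmod x + 1)%R).
assert (hx := Cmod_ge_0 x).
assert (hrho : (0 <= 4 * rho)%R) by (unfold rho; lra).
set (B := Series (fun n => (Cmod (a n) * (4 * rho) ^ n)%R)).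
assert (hB : (0 <= B)%R).
{ unfold B. rewrite <- (Rmult_0_l B). unfold B. rewrite <- Series_scal_l.
  apply Series_le; [|exact (Ha _ hrho)].
  intros n. rewrite Rmult_0_l. split; [lra|].
  apply Rmult_le_pos; [apply Cmod_ge_0|apply pow_le; lra]. }
assert (Hd : abs_summable (fun n => a n * (RtoC (INR n) * x ^ pred n))).
{ apply (ex_series_incr_1 (K := R_AbsRing) (V := R_NormedModule)
           (fun n => Cmod (a n * (RtoC (INR n) * x ^ pred n)))).
  generalize (abs_summable_powser _ x (entire_coeffs_derive a Ha)).
  apply ex_series_ext. intros n. f_equal. simpl pred. ring. }
assert (Ed : CSeries (fun n => a n * (RtoC (INR n) * x ^ pred n))
             = powser (fun n => RtoC (INR (S n)) * a (S n)) x).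
{ rewrite CSeries_incr_1 by exact Hd. simpl (INR 0).
  replace (a 0%nat * (RtoC 0 * x ^ pred 0)) with (RtoC 0) by ring.
  rewrite Cplus_0_l. apply CSeries_ext. intros n. simpl pred. ring. }
rewrite <- Ed.
assert (Q : forall z, (Cmod (z - x) < 1)%R ->
  (Cmod (powser a z - powser a x
         - (z - x) * CSeries (fun n => a n * (RtoC (INR n) * x ^ pred n))%C)
   <= 2 * B * Cmod (z - x) * Cmod (z - x))%R).
{ intros z hz.
  assert (E : powser a z - powser a x
            - (z - x) * CSeries (fun n => a n * (RtoC (INR n) * x ^ pred n))
    = CSeries (fun n => a n *
        (z ^ n - x ^ n - (z - x) * (RtoC (INR n) * x ^ pred n)))).
  { unfold powser.
    transitivity (CSeries (fun n => a n * z ^ n)%C + (- RtoC 1) * CSeries (fun n => a n * x ^ n)%C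
      + (- (z - x)) * CSeries (fun n => a n * (RtoC (INR n) * x ^ pred n))%C)%C.
    { ring. }
    assert (Hz := abs_summable_powser a z Ha). assert (Hx := abs_summable_powser a x Ha).
    rewrite <- !CSeries_scal by assumption.
    rewrite <- !CSeries_plus by auto using abs_summable_plus, abs_summable_scal.
    apply CSeries_ext. intros n. ring. }
  rewrite E.
  replace (2 * B * Cmod (z - x) * Cmod (z - x))%R with (2 * (Cmod (z - x) ^ 2 * B))%R by ring.
  unfold B. rewrite <- Series_scal_l.
  apply Cmod_CSeries_le.
  - intros n. rewrite Cmod_mult.
    replace (Cmod (z - x) ^ 2 * (Cmod (a n) * (4 * rho) ^ n))%R
      with (Cmod (a n) * (Cmod (z - x) ^ 2 * (4 * rho) ^ n))%R by ring.
    apply Rmult_le_compat_l; [apply Cmod_ge_0|].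
    apply Cmod_pow_taylor_le; unfold rho; try lra.
    replace z with (x + (z - x)) at 1 by ring.
    eapply Rle_trans; [apply Cmod_triangle|]. lra.
  - exact (ex_series_scal_l (Cmod (z - x) ^ 2)%R _ (Ha _ hrho)). }
intros eps heps.
assert (hD : (0 < eps / (2 * B + 1))%R) by (apply Rdiv_lt_0_compat; lra).
exists (Rmin 1 (eps / (2 * B + 1))). split; [apply Rmin_pos; lra|].
intros z _ hz.
assert (h1 := Rlt_le_trans _ _ _ hz (Rmin_l _ _)).
assert (h2 := Rlt_le_trans _ _ _ hz (Rmin_r _ _)).
eapply Rle_trans; [apply Q; exact h1|].
apply Rmult_le_compat_r; [apply Cmod_ge_0|].
assert (h3 : (Cmod (z - x) * (2 * B + 1) <= eps)%R).
{ apply Rle_trans with (eps / (2 * B + 1) * (2 * B + 1))%R.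
  - apply Rmult_le_compat_r; lra.
  - apply Req_le. field. lra. }
generalize (Cmod_ge_0 (z - x)). nra.
Qed.

(** * The power series solution *)

Fixpoint sol_coeff (q : R) (alpha a0 : C) (n : nat) : C :=
  match n with
  | O => a0
  | S m => (alpha * RtoC q ^ m - 1) / RtoC (INR (S m)) * sol_coeff q alpha a0 m
  end.

Lemma sol_coeff_S (q : R) (alpha a0 : C) (n : nat) :
  RtoC (INR (S n)) * sol_coeff q alpha a0 (S n)
  = (alpha * RtoC q ^ n - 1) * sol_coeff q alpha a0 n.
Proof.
assert (H : RtoC (INR (S n)) <> 0) by (intros E; apply RtoC_inj in E; now apply (not_0_INR (S n))).
cbn [sol_coeff]. field. exact H.
Qed.

Lemma Cmod_sol_coeff_le (q : R) (alpha a0 : C) (n : nat) :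
  (0 <= q <= 1)%R ->
  (Cmod (sol_coeff q alpha a0 n)
     <= Cmod a0 * ((Cmod alpha + 1) ^ n * / INR (Factorial.fact n)))%R.
Proof.
intros hq. induction n as [|n IH].
- simpl. apply Req_le. field.
- assert (HS : (0 < INR (S n))%R) by (apply lt_0_INR; lia).
  assert (HF : (0 < INR (Factorial.fact n))%R) by apply INR_fact_lt_0.
  assert (A : (Cmod (alpha * RtoC q ^ n - 1) <= Cmod alpha + 1)%R).
  { unfold Cminus. eapply Rle_trans; [apply Cmod_triangle|].
    rewrite Cmod_opp, Cmod_1, Cmod_mult, Cmod_pow, Cmod_R, Rabs_pos_eq by lra.
    assert (0 <= q ^ n <= 1 ^ n)%R by (split; [apply pow_le; lra|apply pow_incr; lra]).
    rewrite pow1 in *. generalize (Cmod_ge_0 alpha). nra. }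
  apply Rmult_le_reg_l with (INR (S n)); [exact HS|].
  replace (INR (S n) * Cmod (sol_coeff q alpha a0 (S n)))%R
    with (Cmod (RtoC (INR (S n)) * sol_coeff q alpha a0 (S n))).
  2: { rewrite Cmod_mult, Cmod_R, Rabs_pos_eq by lra. reflexivity. }
  rewrite sol_coeff_S, Cmod_mult.
  change (Factorial.fact (S n)) with (S n * Factorial.fact n)%nat. rewrite mult_INR.
  replace (INR (S n) * (Cmod a0 * ((Cmod alpha + 1) ^ S n * / (INR (S n) * INR (Factorial.fact n)))))%R
    with ((Cmod alpha + 1) * (Cmod a0 * ((Cmod alpha + 1) ^ n * / INR (Factorial.fact n))))%R.
  + apply Rmult_le_compat; auto using Cmod_ge_0.
  + simpl pow. field. lra.
Qed.

Lemma entire_coeffs_sol_coeff (q : R) (alpha a0 : C) :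
  (0 <= q <= 1)%R -> entire_coeffs (sol_coeff q alpha a0).
Proof.
intros hq rho hrho.
assert (H : ex_series (fun n => (Cmod a0 *
   (/ INR (Factorial.fact n) * ((Cmod alpha + 1) * rho) ^ n))%R)).
{ apply (ex_series_scal_l (K := R_AbsRing) (V := R_NormedModule)).
  eexists. apply is_pseries_R, is_exp_Reals. }
apply (ex_series_le (K := R_AbsRing) (V := R_CompleteNormedModule)) with (2 := H).
intros n. assert (P := pow_le rho n hrho). assert (N := Cmod_sol_coeff_le q alpha a0 n hq).
change (Rabs (Cmod (sol_coeff q alpha a0 n) * rho ^ n)
  <= Cmod a0 * (/ INR (Factorial.fact n) * ((Cmod alpha + 1) * rho) ^ n))%R.
rewrite Rabs_pos_eq by (apply Rmult_le_pos; auto using Cmod_ge_0).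
rewrite Rpow_mult_distr.
apply Rmult_le_compat_r with (r := (rho ^ n)%R) in N; [|exact P].
eapply Rle_trans; [exact N|]. apply Req_le. ring.
Qed.

Lemma powser_0 (a : nat -> C) : entire_coeffs a -> powser a 0 = a 0%nat.
Proof.
intros Ha. unfold powser. rewrite CSeries_incr_1 by now apply abs_summable_powser.
replace (CSeries (fun n => a (S n) * 0 ^ S n)) with (0 * CSeries (fun n => a n * 0 ^ n)).
- simpl. ring.
- rewrite <- CSeries_scal by now apply abs_summable_powser.
  apply CSeries_ext. intros n. rewrite Cpow_S. ring.
Qed.

(** Rewriting the differentiated series by the recurrence [sol_coeff_S] splits it
    into [alpha f (q x)] and [- f x], since [q^n x^n = (q x)^n]. *)
Lemma is_derive_powser_sol (q : R) (alpha a0 x : C) :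
  (0 <= q <= 1)%R ->
  let f := powser (sol_coeff q alpha a0) in
  is_derive_on (fun _ => True) f x (alpha * f (RtoC q * x) - f x).
Proof.
intros hq f. assert (Ha := entire_coeffs_sol_coeff q alpha a0 hq).
replace (alpha * f (RtoC q * x) - f x)
  with (powser (fun n => RtoC (INR (S n)) * sol_coeff q alpha a0 (S n)) x).
- now apply is_derive_powser.
- transitivity (alpha * f (RtoC q * x) + (- RtoC 1) * f x); [|ring].
  unfold f, powser. assert (H := fun z => abs_summable_powser _ z Ha).
  rewrite <- !CSeries_scal by auto.
  rewrite <- CSeries_plus by (apply abs_summable_scal; auto).
  apply CSeries_ext. intros n. rewrite sol_coeff_S, Cpow_mult_l. ring.
Qed.

(** * Uniqueness along the segment *)

Lemma Cmod_expi (d : R) : Cmod (expi d) = 1%R.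
Proof.
transitivity (sqrt 1); [|apply sqrt_1]. unfold Cmod, expi; simpl. f_equal.
generalize (sin2_cos2 d). unfold Rsqr. lra.
Qed.

(** Reduces estimates of the modulus of a complex vector to estimates of the real
    parts of its rotations, for which the real mean value theorem is available. *)
Lemma exists_phase (v : C) : exists c : C, Cmod c = 1%R /\ Re (c * v) = Cmod v.
Proof.
destruct (Req_dec (Cmod v) 0) as [E|E].
- exists 1. rewrite Cmod_1, E. apply Cmod_eq_0 in E. subst v. split; [reflexivity|].
  simpl. ring.
- assert (P : (0 < Cmod v)%R) by (generalize (Cmod_ge_0 v); lra).
  exists (RtoC (/ Cmod v) * Cconj v). split.
  + rewrite Cmod_mult, Cmod_R, Cmod_conj, Rabs_pos_eq; [now field|].
    left. now apply Rinv_0_lt_compat.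
  + rewrite <- Cmult_assoc, re_scal_l, (Cmult_comm (Cconj v)), <- Cmod2_conj.
    simpl. field. exact E.
Qed.

(** The parameter is clamped at 0, so that functions on the segment become functions
    on a whole neighbourhood of 0 and one-sided continuity at the origin becomes
    ordinary continuity. *)
Definition ray (d t : R) : C := RtoC (Rmax 0 t) * expi d.

Lemma ray_pos (d t : R) : (0 <= t)%R -> ray d t = RtoC t * expi d.
Proof. intros h. unfold ray. now rewrite Rmax_right. Qed.

Lemma segment_ray (r d t : R) : (0 < r)%R -> (t < r)%R -> segment r d (ray d t).
Proof.
intros hr ht. exists (Rmax 0 t). split; [|reflexivity].
split; [apply Rmax_l|now apply Rmax_lub_lt].
Qed.

Lemma Cmod_ray_minus_le (d s t : R) : (Cmod (ray d s - ray d t) <= Rabs (s - t))%R.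
Proof.
unfold ray.
replace (RtoC (Rmax 0 s) * expi d - RtoC (Rmax 0 t) * expi d)
  with (RtoC (Rmax 0 s - Rmax 0 t) * expi d) by (rewrite RtoC_minus; ring).
rewrite Cmod_mult, Cmod_expi, Cmod_R.
rewrite Rmult_1_r. unfold Rmax, Rabs.
repeat destruct Rle_dec; repeat destruct Rcase_abs; lra.
Qed.

(** Stated for a 1-Lipschitz real function [p] of the value, since it is used both for
    the modulus and for the real part after a rotation. *)
Lemma continuous_along_ray (r d t : R) (w : C -> C) (l : C) (p : C -> R) :
  (0 <= t < r)%R -> is_derive_on (segment r d) w (ray d t) l ->
  (forall u v, (Rabs (p u - p v) <= Cmod (u - v))%R) ->
  continuity_pt (fun s => p (w (ray d s))) t.
Proof.
intros ht H Hp. assert (hr : (0 < r)%R) by lra.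
rewrite is_derive_on_iff in H by (apply segment_ray; lra).
destruct (H 1%R Rlt_0_1) as [delta [Pd Hd]].
intros eps heps. assert (hl := Cmod_ge_0 l).
assert (he : (0 < eps / (Cmod l + 1))%R) by (apply Rdiv_lt_0_compat; lra).
exists (Rmin (Rmin delta (r - t)) (eps / (Cmod l + 1))). split.
- repeat apply Rmin_pos; lra.
- intros s [_ hs]. simpl in hs |- *. unfold Rdist in *.
  assert (h1 := Rlt_le_trans _ _ _ hs (Rmin_r _ _)).
  assert (h2 := Rlt_le_trans _ _ _ hs (Rmin_l _ _)).
  assert (h3 := Rlt_le_trans _ _ _ h2 (Rmin_r _ _)).
  assert (h4 := Rlt_le_trans _ _ _ h2 (Rmin_l _ _)).
  assert (hst : (s < r)%R) by (generalize (Rle_abs (s - t)); lra).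
  assert (hray := Cmod_ray_minus_le d s t).
  specialize (Hd (ray d s) (segment_ray r d s hr hst) ltac:(lra)).
  eapply Rle_lt_trans; [apply Hp|].
  set (D := ray d s - ray d t) in *.
  replace (w (ray d s) - w (ray d t)) with ((w (ray d s) - w (ray d t) - D * l) + D * l) by ring.
  eapply Rle_lt_trans; [apply Cmod_triangle|]. rewrite Cmod_mult.
  apply Rle_lt_trans with (Rabs (s - t) * (Cmod l + 1))%R; [nra|].
  apply Rlt_le_trans with (eps / (Cmod l + 1) * (Cmod l + 1))%R.
  + apply Rmult_lt_compat_r; lra.
  + apply Req_le. field. lra.
Qed.

Lemma is_derive_along_ray (r d t : R) (w : C -> C) (l c : C) :
  (0 < t < r)%R -> is_derive_on (segment r d) w (ray d t) l -> Cmod c = 1%R ->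
  is_derive (fun s => Re (c * w (ray d s))) t (Re (c * (expi d * l))).
Proof.
intros ht H hc. assert (hr : (0 < r)%R) by lra.
rewrite is_derive_on_iff in H by (apply segment_ray; lra).
apply is_derive_Reals. intros eps heps.
destruct (H (eps / 2)%R ltac:(lra)) as [delta [Pd Hd]].
assert (P : (0 < Rmin delta (Rmin t (r - t)))%R) by (repeat apply Rmin_pos; lra).
exists (mkposreal _ P). intros h hh0 hh. simpl in hh.
assert (h1 := Rlt_le_trans _ _ _ hh (Rmin_l _ _)).
assert (h2 := Rlt_le_trans _ _ _ hh (Rmin_r _ _)).
assert (h3 := Rlt_le_trans _ _ _ h2 (Rmin_l _ _)).
assert (h4 := Rlt_le_trans _ _ _ h2 (Rmin_r _ _)).
apply Rabs_def2 in h3. apply Rabs_def2 in h4.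
assert (ED : ray d (t + h) - ray d t = RtoC h * expi d).
{ rewrite !ray_pos by lra. rewrite RtoC_plus. ring. }
assert (EM : Cmod (RtoC h * expi d) = Rabs h).
{ rewrite Cmod_mult, Cmod_expi, Cmod_R. ring. }
specialize (Hd (ray d (t + h)) ltac:(apply segment_ray; lra)).
rewrite ED, EM in Hd. specialize (Hd h1).
set (E := w (ray d (t + h)) - w (ray d t) - RtoC h * expi d * l) in Hd.
replace ((Re (c * w (ray d (t + h))) - Re (c * w (ray d t))) / h - Re (c * (expi d * l)))%R
  with (Re (c * E) / h)%R.
2: { replace (c * E) with (c * w (ray d (t + h)) + - (c * w (ray d t))
       + - (RtoC h * (c * (expi d * l)))) by (unfold E; ring).
     rewrite !re_plus, !re_opp, re_scal_l. now field. }
unfold Rdiv. rewrite Rabs_mult, Rabs_inv.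
assert (Ph : (0 < Rabs h)%R) by now apply Rabs_pos_lt.
assert (Q : (Rabs (Re (c * E)) <= eps / 2 * Rabs h)%R).
{ eapply Rle_trans; [apply re_le_Cmod|]. rewrite Cmod_mult, hc. lra. }
apply Rle_lt_trans with (eps / 2 * Rabs h * / Rabs h)%R.
- apply Rmult_le_compat_r; [|exact Q]. left. now apply Rinv_0_lt_compat.
- field_simplify; lra.
Qed.

(** With [c] a unit number rotating [w (ray d b) - w (ray d 0)] onto the positive real
    axis, the real function [Re (c * w) - g] has nonpositive derivative on
    [0 < t < b], so it does not increase. *)
Lemma mean_value_along_ray (r d b : R) (w l : C -> C) (g g' : R -> R) :
  (0 <= b < r)%R ->
  (forall x, segment r d x -> is_derive_on (segment r d) w x (l x)) ->
  (forall t, is_derive g t (g' t)) ->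
  (forall t, (0 <= t <= b)%R -> (Cmod (l (ray d t)) <= g' t)%R) ->
  (Cmod (w (ray d b) - w (ray d 0)) <= g b - g 0)%R.
Proof.
intros hb Hw Hg Hl.
destruct (exists_phase (w (ray d b) - w (ray d 0))) as [c [hc Ec]].
rewrite <- Ec.
set (phi := fun t => (Re (c * w (ray d t)) - g t)%R).
set (dphi := fun t => (Re (c * (expi d * l (ray d t))) - g' t)%R).
assert (Hseg : forall t, (0 <= t <= b)%R -> segment r d (ray d t))
  by (intros t ht; apply segment_ray; lra).
destruct (MVT_gen phi 0 b dphi) as [xi [hxi Exi]].
- rewrite Rmin_left, Rmax_right by lra. intros t ht.
  apply (is_derive_minus (K := R_AbsRing) (V := R_NormedModule)
    (fun t => Re (c * w (ray d t))) g); [|apply Hg].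
  apply is_derive_along_ray with r; auto; [lra|]. apply Hw, Hseg; lra.
- rewrite Rmin_left, Rmax_right by lra. intros t ht.
  apply continuity_pt_minus.
  + apply (continuous_along_ray r d t w (l (ray d t)) (fun v => Re (c * v))); [lra|auto|].
    intros u v.
    replace (Re (c * u) - Re (c * v))%R with (Re (c * (u - v))).
    * eapply Rle_trans; [apply re_le_Cmod|]. rewrite Cmod_mult, hc. lra.
    * rewrite !re_mult. unfold Re, Im; simpl. ring.
  + apply derivable_continuous_pt. exists (g' t). apply is_derive_Reals, Hg.
- rewrite Rmin_left, Rmax_right in hxi by lra.
  assert (Hneg : (dphi xi <= 0)%R).
  { unfold dphi.
    assert (H := Rle_trans _ _ _ (Rle_abs _) (re_le_Cmod (c * (expi d * l (ray d xi))))).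
    rewrite !Cmod_mult, hc, Cmod_expi in H. specialize (Hl xi hxi). lra. }
  replace (Re (c * (w (ray d b) - w (ray d 0))))
    with (Re (c * w (ray d b)) - Re (c * w (ray d 0)))%R
    by (rewrite !re_mult; unfold Re, Im; simpl; ring).
  unfold phi in Exi. nra.
Qed.

(** The values at [q t] obey the same bound as those at [t] because the weight
    [exp (L t)] is increasing; so the derivative is at most
    [(|alpha| + 1) M exp (L t)], which is the derivative of
    [(M / 2) exp (L t)] for this choice of [L]. *)
Lemma solution_bound_halves (q : R) (alpha : C) (r d T M : R) (w : C -> C) :
  (0 <= q <= 1)%R -> (T < r)%R ->
  (forall x, segment r d x ->
     is_derive_on (segment r d) w x (alpha * w (RtoC q * x) - w x)) ->
  w 0 = 0 ->
  let L := (2 * (Cmod alpha + 1))%R in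
  (forall t, (0 <= t <= T)%R -> (Cmod (w (ray d t)) <= M * exp (L * t))%R) ->
  forall t, (0 <= t <= T)%R -> (Cmod (w (ray d t)) <= M / 2 * exp (L * t))%R.
Proof.
intros hq hT Hw w0 L HM b hb. assert (ha := Cmod_ge_0 alpha).
assert (hM : (0 <= M)%R).
{ assert (H := HM 0%R ltac:(lra)). rewrite Rmult_0_r, exp_0 in H.
  generalize (Cmod_ge_0 (w (ray d 0))). lra. }
assert (Hmv : (Cmod (w (ray d b) - w (ray d 0))
               <= M / 2 * exp (L * b) - M / 2 * exp (L * 0))%R).
{ apply (mean_value_along_ray r d b w (fun x => alpha * w (RtoC q * x) - w x)
    (fun t => M / 2 * exp (L * t))%R (fun t => M / 2 * (L * exp (L * t)))%R); auto; [lra| |].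
  - intros t. auto_derive; [exact I|ring].
  - intros t ht.
    assert (Hqt : (0 <= q * t <= t)%R) by nra.
    assert (Eq : RtoC q * ray d t = ray d (q * t)).
    { rewrite !ray_pos by lra. rewrite RtoC_mult. ring. }
    rewrite Eq. unfold Cminus. eapply Rle_trans; [apply Cmod_triangle|].
    rewrite Cmod_opp, Cmod_mult.
    assert (H1 := HM (q * t)%R ltac:(lra)). assert (H2 := HM t ltac:(lra)).
    assert (H3 : (exp (L * (q * t)) <= exp (L * t))%R).
    { destruct (Rle_lt_or_eq_dec (L * (q * t)) (L * t)) as [H|H].
      - unfold L. nra.
      - left. now apply exp_increasing.
      - right. now rewrite H. }
    assert (H4 : (Cmod (w (ray d (q * t))) <= M * exp (L * t))%R) by nra.
    unfold L at 1.
    apply Rle_trans with (Cmod alpha * (M * exp (L * t)) + M * exp (L * t))%R; [nra|].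
    apply Req_le. field. }
assert (E0 : w (ray d 0) = 0).
{ rewrite ray_pos by lra. rewrite Cmult_0_l. exact w0. }
rewrite E0 in Hmv. unfold Cminus in Hmv. rewrite Copp_0, Cplus_0_r, Rmult_0_r, exp_0 in Hmv.
lra.
Qed.

(** The point at parameter [T] is reached by halving, again and again, a bound valid
    on the compact interval [0 <= t <= T]. *)
Lemma solution_vanishes (q : R) (alpha : C) (r d : R) (w : C -> C) :
  (0 <= q <= 1)%R ->
  (forall x, segment r d x ->
     is_derive_on (segment r d) w x (alpha * w (RtoC q * x) - w x)) ->
  w 0 = 0 ->
  forall x, segment r d x -> w x = 0.
Proof.
intros hq Hw w0 x [T [hT ->]].
rewrite <- ray_pos by lra.
set (L := (2 * (Cmod alpha + 1))%R).
destruct (continuity_ab_maj (fun t => Cmod (w (ray d t))) 0 T) as [m [Hm _]]; [lra| |].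
{ intros t ht. apply (continuous_along_ray r d t w
    (alpha * w (RtoC q * ray d t) - w (ray d t)) Cmod); [lra| |].
  - apply Hw, segment_ray; lra.
  - intros u v. exact (norm_triangle_inv (K := C_AbsRing) (V := C_NormedModule) u v). }
set (M := Cmod (w (ray d m))) in *.
assert (HL : (0 <= L)%R) by (unfold L; generalize (Cmod_ge_0 alpha); lra).
assert (B : forall n t, (0 <= t <= T)%R ->
  (Cmod (w (ray d t)) <= M * (/ 2) ^ n * exp (L * t))%R).
{ induction n as [|n IH].
  - intros t ht. eapply Rle_trans; [exact (Hm t ht)|].
    assert (1 <= exp (L * t))%R.
    { generalize (exp_ineq1_le (L * t)). nra. }
    assert (0 <= M)%R by apply Cmod_ge_0. simpl. nra.
  - intros t ht. replace (M * (/ 2) ^ S n)%R with (M * (/ 2) ^ n / 2)%R by (simpl; field).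
    apply (solution_bound_halves q alpha r d T); auto; lra. }
apply Cmod_eq_0, Rle_antisym; [|apply Cmod_ge_0].
apply (is_lim_seq_le (fun _ => Cmod (w (ray d T)))
         (fun n => (M * exp (L * T)) * (/ 2) ^ n)%R (Cmod (w (ray d T))) 0%R).
- intros n. specialize (B n T ltac:(lra)). lra.
- apply is_lim_seq_const.
- replace (Finite 0) with (Rbar_mult (M * exp (L * T))%R 0%R)
    by (simpl; f_equal; ring).
  apply is_lim_seq_scal_l, is_lim_seq_geom. rewrite Rabs_pos_eq; lra.
Qed.

Theorem proposition1p1 (q : R) (alpha : C) (d r : R)
    (hq : (0 < q < 1)%R) (halpha : alpha <> RtoC 0) (hr : (0 < r)%R) :
  (forall y : C -> C,
     smooth_solution_on q alpha (segment r d) y ->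
     exists f : C -> C,
       entire f /\ (forall x : C, segment r d x -> f x = y x)) /\
  ~ (exists y : C -> C,
       smooth_solution_on q alpha (segment r d) y /\
       y (RtoC 0) = RtoC 0 /\
       (exists x : C, segment r d x /\ y x <> RtoC 0)).
Proof.
assert (hq' : (0 <= q <= 1)%R) by lra.
split.
- intros y [_ Hy].
  set (f := powser (sol_coeff q alpha (y 0))).
  assert (Hf := fun x => is_derive_powser_sol q alpha (y 0) x hq').
  exists f. split.
  + intros z. eexists. apply is_derive_on_full, Hf.
  + intros x Hx. symmetry. apply Cminus_eq_0.
    apply (solution_vanishes q alpha r d (fun z => y z - f z)); [exact hq'| | |exact Hx].
    * intros z Hz.
      replace (alpha * (y (RtoC q * z) - f (RtoC q * z)) - (y z - f z))
        with ((alpha * y (RtoC q * z) - y z) - (alpha * f (RtoC q * z) - f z)) by ring.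
      apply is_derive_on_minus; auto.
      apply is_derive_on_subset with (fun _ => True); auto.
    * unfold f. rewrite powser_0 by now apply entire_coeffs_sol_coeff.
      simpl. ring.
- intros [y [[_ Hy] [y0 [x [Hx Hyx]]]]]. apply Hyx.
  now apply (solution_vanishes q alpha r d y).
Qed.
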